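(* Let $\gamma$ be a precomplete $\omega$-divisible numbering and let $A \subseteq \omega$. Then the following are equivalent: (1) $A$ is computable. (2) $A$ is $\gamma$-low. (3) $\gamma$ is $A$-precomplete. In particular, this equivalence holds when $\gamma$ is one of the standard numberings $W_{(-)} : n \mapsto W_n$ of the c.e. sets and $\varphi_{(-)} : n \mapsto \varphi_n$ of the partial computable functions.
   Context: $\omega$ is the set of natural numbers; oracles are subsets of $\omega$. $\varphi^A_n$ is the $n$-th partial $A$-computable function and $W^A_n$ the $n$-th $A$-c.e. set ($W^A_n$ being the domain of $\varphi^A_n$) in the standard numberings; $\varphi_n$ and $W_n$ are the unrelativized versions. A numbering is a surjection $\gamma:\omega\to S$ onto a set $S$; write $n\sim_\gamma m$ iff $\gamma(n)=\gamma(m)$, and let $[x]_{\sim_\gamma}$ be the equivalence class of $x$. A numbering $\gamma$ is $A$-precomplete if for every partial $A$-computable function $\psi$ there is a total $A$-computable function $f$ such that for every $n$, if $\psi(n)$ is defined then $\psi(n)\sim_\gamma f(n)$. Precomplete means $\emptyset$-precomplete. $A$ is $\gamma$-low if for every (total) $A$-computable function $f$ there is a computable function $g$ with $f(n)\sim_\gamma g(n)$ for all $n$. $\gamma$ is $\omega$-divisible if there are computable sequences $(x_i)_{i<\omega}$ and $(e_i)_{i<\omega}$ of natural numbers such that (i) $[x_i]_{\sim_\gamma}\subseteq W_{e_i}$ for all $i$, and (ii) $[x_i]_{\sim_\gamma}\cap W_{e_j}=\emptyset$ for all distinct $i,j$. *)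

(* Defs.v *)
From Stdlib Require Import Cantor.
From mathcomp Require Import all_boot.
From mathcomp Require Import zify.
From mathcomp Require Import boolp classical_sets.

Set Implicit Arguments.
Unset Strict Implicit.
Unset Printing Implicit Defensive.

Local Open Scope classical_set_scope.

(* The model of computation is Kleene's: the partial A-computable functions
   are generated from zero, successor, the projections of a pairing bijection
   and the characteristic function of A by pairing, composition, primitive
   recursion and unbounded minimization.  All functions are unary; several
   arguments are passed through the Cantor pairing.  A partial function is
   represented by its graph [nat -> nat -> Prop]. *)

Definition npair (x y : nat) : nat := Cantor.to_nat (x, y).
Definition nfst (z : nat) : nat := (Cantor.of_nat z).1.
Definition nsnd (z : nat) : nat := (Cantor.of_nat z).2.

Inductive code : Type :=
| CZero | CSucc | CFst | CSnd | COracle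
| CPair of code & code
| CComp of code & code
| CPrec of code & code
| CMu of code.

Definition charfun (A : set nat) (n : nat) : nat := `[< A n >].

(* F gives the value at 0, and G the value at m.+1 from a, m and the value
   at m. *)
Fixpoint prec_graph (F G : nat -> nat -> Prop) (a n y : nat) : Prop :=
  match n with
  | 0 => F a y
  | m.+1 => exists2 z, prec_graph F G a m z & G (npair a (npair m z)) y
  end.

Fixpoint eval (A : set nat) (c : code) (x y : nat) : Prop :=
  match c with
  | CZero => y = 0
  | CSucc => y = x.+1
  | CFst => y = nfst x
  | CSnd => y = nsnd x
  | COracle => y = charfun A x
  | CPair c1 c2 => exists u v, [/\ eval A c1 x u, eval A c2 x v & y = npair u v]
  | CComp c1 c2 => exists2 z, eval A c2 x z & eval A c1 z y
  | CPrec c1 c2 => prec_graph (eval A c1) (eval A c2) (nfst x) (nsnd x) y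
  | CMu c1 => eval A c1 (npair x y) 0 /\
              forall m, m < y -> exists k, eval A c1 (npair x m) k.+1
  end.

Lemma eval_functional A c x y y' : eval A c x y -> eval A c x y' -> y = y'.
Proof.
elim: c x y y' => [|||||c1 IH1 c2 IH2|c1 IH1 c2 IH2|c1 IH1 c2 IH2|c1 IH1] x y y' /=.
1-5: by move=> -> ->.
- move=> [u [v [hu hv ->]]] [u' [v' [hu' hv' ->]]].
  by rewrite (IH1 _ _ _ hu hu') (IH2 _ _ _ hv hv').
- by move=> [z hz hy] [z' hz' hy']; rewrite -(IH2 _ _ _ hz hz') in hy'; apply: IH1 hy hy'.
- elim: (nsnd x) y y' => [|m IHm] y y' /=; first exact: IH1.
  by move=> [z hz hy] [z' hz' hy']; rewrite -(IHm _ _ hz hz') in hy'; apply: IH2 hy hy'.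
- move=> [h0 hlt] [h0' hlt']; case: (ltngtP y y') => // lt_yy.
  + by have [k hk] := hlt' _ lt_yy; have := IH1 _ _ _ h0 hk.
  + by have [k hk] := hlt _ lt_yy; have := IH1 _ _ _ h0' hk.
Qed.

Fixpoint encode (c : code) : nat :=
  match c with
  | CZero => 0
  | CSucc => 1
  | CFst => 2
  | CSnd => 3
  | COracle => 4
  | CPair c1 c2 => 5 + 4 * npair (encode c1) (encode c2)
  | CComp c1 c2 => 6 + 4 * npair (encode c1) (encode c2)
  | CPrec c1 c2 => 7 + 4 * npair (encode c1) (encode c2)
  | CMu c1 => 8 + 4 * encode c1
  end.

Lemma npair_inj x y x' y' : npair x y = npair x' y' -> x = x' /\ y = y'.
Proof.
by move=> /(f_equal Cantor.of_nat); rewrite !Cantor.cancel_of_to => -[].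
Qed.

Lemma encode_inj : injective encode.
Proof.
elim=> [|||||c1 IH1 c2 IH2|c1 IH1 c2 IH2|c1 IH1 c2 IH2|c1 IH1];
  case=> [|||||d1 d2|d1 d2|d1 d2|d1] //= E; try lia.
4: by congr CMu; apply: IH1; lia.
all: have /npair_inj[/IH1 -> /IH2 ->] :
  npair (encode c1) (encode c2) = npair (encode d1) (encode d2) by lia.
all: by [].
Qed.

Lemma encode_surj n : exists c, encode c = n.
Proof.
elim/ltn_ind: n => n IH.
have [lt5|ge5] := ltnP n 5.
  by case: n lt5 {IH} => [|[|[|[|[|n]]]]] // _;
    [exists CZero|exists CSucc|exists CFst|exists CSnd|exists COracle].
pose q := (n - 5) %/ 4; pose r := (n - 5) %% 4.
have En : n = 5 + r + 4 * q by rewrite /q /r; lia.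
have r4 : r < 4 by rewrite /r ltn_mod.
have Eq : q = npair (nfst q) (nsnd q).
  by rewrite /npair /nfst /nsnd -surjective_pairing Cantor.cancel_to_of.
have le_q : nsnd q + nfst q <= q.
  by rewrite {3}Eq; apply/leP; apply: Cantor.to_nat_non_decreasing.
have [c1 E1] : exists c, encode c = nfst q by apply: IH; lia.
have [c2 E2] : exists c, encode c = nsnd q by apply: IH; lia.
have [c3 E3] : exists c, encode c = q by apply: IH; lia.
case: r En r4 => [|[|[|[|r]]]] En // _.
- by exists (CPair c1 c2); rewrite /= E1 E2 -Eq En.
- by exists (CComp c1 c2); rewrite /= E1 E2 -Eq En.
- by exists (CPrec c1 c2); rewrite /= E1 E2 -Eq En.
- by exists (CMu c3); rewrite /= E3 En.
Qed.

(* By [encode_inj] and [encode_surj], n is the index of exactly one code. *)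
Definition phi (A : set nat) (n x y : nat) : Prop :=
  exists2 c, encode c = n & eval A c x y.

Definition W (A : set nat) (n : nat) : set nat := [set x | exists y, phi A n x y].

Definition partial_computable_in (A : set nat) : set (nat -> nat -> Prop) :=
  range (phi A).

Definition ce_in (A : set nat) : set (set nat) := range (W A).

Definition computable_in (A : set nat) (f : nat -> nat) : Prop :=
  partial_computable_in A (fun x y => y = f x).

Definition computable_set (A : set nat) : Prop := computable_in set0 (charfun A).

Definition numbering T (S : set T) (gamma : nat -> T) : Prop := range gamma = S.

Definition equiv_class T (gamma : nat -> T) (x : nat) : set nat :=
  [set y | gamma y = gamma x].

Definition precomplete_in (A : set nat) T (gamma : nat -> T) : Prop :=
  forall psi, partial_computable_in A psi ->
  exists2 f, computable_in A f &
    forall n v, psi n v -> gamma v = gamma (f n).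

Definition precomplete T (gamma : nat -> T) : Prop := precomplete_in set0 gamma.

Definition low T (gamma : nat -> T) (A : set nat) : Prop :=
  forall f, computable_in A f ->
  exists2 g, computable_in set0 g & forall n, gamma (f n) = gamma (g n).

Definition omega_divisible T (gamma : nat -> T) : Prop :=
  exists x e : nat -> nat,
    [/\ computable_in set0 x, computable_in set0 e,
        forall i, equiv_class gamma (x i) `<=` W set0 (e i) &
        forall i j, i <> j -> equiv_class gamma (x i) `&` W set0 (e j) = set0].

Lemma numbering_W : numbering (ce_in set0) (W set0).
Proof. by []. Qed.

Lemma numbering_phi : numbering (partial_computable_in set0) (phi set0).
Proof. by []. Qed.

(* Main.v *)
Require Import Defs.
From Stdlib Require Import Cantor.
From mathcomp Require Import all_boot.
From mathcomp Require Import zify.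
From mathcomp Require Import boolp classical_sets.

(** Why the theorem holds.  If A is computable, then A-computability is plain
    computability, so that lowness is immediate and precompleteness is
    A-precompleteness ([partial_computable_trans]).

    Both converses read i off from a representative p of the class of x i.
    A division makes this computable: search for some j such that p is
    enumerated into the c.e. set with index e j; there is such a j, namely i,
    and disjointness excludes all others ([omega_divisible_decode]).  If A is
    low, replace the A-computable function n |-> x (A n) by a computable one
    with equivalent values; decoding these values gives A.

    If gamma is A-precomplete, a finite amount of information is spread out
    along a self-referential sequence ([precomplete_in_computable_set]).  Let f
    be an A-computable function that makes a universal partial A-computable
    function total modulo gamma.  A program that knows f and its own index a
    can output, on the input m, the element x i for the i that codes the pair
    (f(a, m + 1), A m).  Then f(a, m) is equivalent to x i, and decoding i
    without oracle leads from f(a, m) to the bit A m and to f(a, m + 1).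
    Hence the one number f(a, 0) is enough to compute all of A.  It is here
    that infinitely many classes are needed: two would carry a single bit from
    each f(a, m), but not the next number of the sequence.

    For the standard numberings, precompleteness is the s-m-n theorem applied
    to the universal function, and the classes of the singletons {i} are
    divided by the c.e. sets of those n for which i lies in W_n.

    All this rests on a universal function for Kleene's codes.  It is obtained
    from a stack machine acting on numbers, whose single step is primitive
    recursive; running the machine for t steps yields Kleene's normal form
    ([normal_form]), and minimization over t yields the universal function
    ([universal_code]) and the search for j above ([ce_selection]). *)

Set Implicit Arguments.
Unset Strict Implicit.
Unset Printing Implicit Defensive.

(** * Pairing and graphs of codes *)

Arguments npair : simpl never.
Arguments nfst : simpl never.
Arguments nsnd : simpl never.

Lemma nfst_npair x y : nfst (npair x y) = x.
Proof. by rewrite /nfst /npair Cantor.cancel_of_to. Qed.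

Lemma nsnd_npair x y : nsnd (npair x y) = y.
Proof. by rewrite /nsnd /npair Cantor.cancel_of_to. Qed.

Lemma npair_eta z : npair (nfst z) (nsnd z) = z.
Proof. by rewrite /npair -surjective_pairing Cantor.cancel_to_of. Qed.

Definition npairE := (nfst_npair, nsnd_npair).

Lemma phi_encode A c : phi A (encode c) = eval A c.
Proof.
apply/funext => x; apply/funext => y; apply/propext; split; last by exists c.
by move=> [c' /encode_inj ->].
Qed.

Lemma phi_functional A e x y y' : phi A e x y -> phi A e x y' -> y = y'.
Proof.
by have [c <-] := encode_surj e; rewrite phi_encode; exact: eval_functional.
Qed.

Lemma partial_computableP A psi :
  partial_computable_in A psi <-> exists c, psi = eval A c.
Proof.
split=> [[n _ <-]|[c ->]].
  by have [c <-] := encode_surj n; exists c; rewrite phi_encode.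
by exists (encode c); rewrite ?phi_encode.
Qed.

(** As codes have functional graphs, only the values have to be checked. *)
Lemma computableP A f :
  computable_in A f <-> exists c, forall x, eval A c x (f x).
Proof.
split=> [/partial_computableP[c Ec]|[c Ec]].
  by exists c => x; rewrite -Ec.
apply/partial_computableP; exists c; apply/funext => x; apply/funext => y.
by apply/propext; split=> [->//|/eval_functional]; apply.
Qed.

(** * Closure properties of the computable functions *)

Definition CId := CPair CFst CSnd.

Lemma eval_CIdP A x y : eval A CId x y <-> y = x.
Proof.
split=> [/= [_ [_ [-> -> ->]]]|->]; first exact: npair_eta.
by exists (nfst x), (nsnd x); rewrite npair_eta.
Qed.

Lemma eval_CId A x : eval A CId x x.
Proof. exact/eval_CIdP. Qed.

Section Closure.
Variable A : set nat.
Implicit Types f g h : nat -> nat.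

Definition decidable_in (b : nat -> bool) := computable_in A (fun x => b x).

Lemma computable_id : computable_in A (fun x => x).
Proof. by apply/computableP; exists CId => x; exact: eval_CId. Qed.

Lemma computable_comp f g :
  computable_in A f -> computable_in A g -> computable_in A (fun x => f (g x)).
Proof.
move=> /computableP[c Ec] /computableP[d Ed]; apply/computableP.
by exists (CComp c d) => x; exists (g x).
Qed.

Lemma computable_succ f :
  computable_in A f -> computable_in A (fun x => (f x).+1).
Proof. by apply: (@computable_comp succn); apply/computableP; exists CSucc. Qed.

Lemma computable_fst f :
  computable_in A f -> computable_in A (fun x => nfst (f x)).
Proof. by apply: (@computable_comp nfst); apply/computableP; exists CFst. Qed.

Lemma computable_snd f :
  computable_in A f -> computable_in A (fun x => nsnd (f x)).
Proof. by apply: (@computable_comp nsnd); apply/computableP; exists CSnd. Qed.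

Lemma computable_charfun f :
  computable_in A f -> computable_in A (fun x => charfun A (f x)).
Proof.
by apply: (@computable_comp (charfun A)); apply/computableP; exists COracle.
Qed.

Lemma computable_const n : computable_in A (fun=> n).
Proof.
elim: n => [|n IHn]; first by apply/computableP; exists CZero.
exact: computable_succ.
Qed.

Lemma computable_pair f g :
  computable_in A f -> computable_in A g ->
  computable_in A (fun x => npair (f x) (g x)).
Proof.
move=> /computableP[c Ec] /computableP[d Ed]; apply/computableP.
by exists (CPair c d) => x; exists (f x), (g x).
Qed.

Lemma computable_primrec (h : nat -> nat -> nat) F G f n :
  (forall a, h a 0 = F a) ->
  (forall a m, h a m.+1 = G (npair a (npair m (h a m)))) ->
  computable_in A F -> computable_in A G ->
  computable_in A f -> computable_in A n ->
  computable_in A (fun x => h (f x) (n x)).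
Proof.
move=> h0 hS /computableP[cF EF] /computableP[cG EG] compf compn.
have comp_h : computable_in A (fun z => h (nfst z) (nsnd z)).
  apply/computableP; exists (CPrec cF cG) => z /=.
  elim: (nsnd z) => [|m IHm] /=; first by rewrite h0.
  by exists (h (nfst z) m); rewrite ?hS.
have := computable_comp comp_h (computable_pair compf compn).
by congr computable_in; apply/funext => x; rewrite !npairE.
Qed.

Lemma computable_pred f :
  computable_in A f -> computable_in A (fun x => (f x).-1).
Proof.
apply: (@computable_primrec (fun _ => predn) (fun=> 0)
  (fun z => nfst (nsnd z)) (fun=> 0)) => //; try exact: computable_const.
  by move=> a m; rewrite !npairE.
exact/computable_fst/computable_snd/computable_id.
Qed.

Lemma computable_iter F n f :
  computable_in A F -> computable_in A n -> computable_in A f ->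
  computable_in A (fun x => iter (n x) F (f x)).
Proof.
move=> compF compn compf.
apply: (@computable_primrec (fun a m => iter m F a) id
  (fun z => F (nsnd (nsnd z))) f n) => //.
- by move=> a m; rewrite !npairE.
- exact: computable_id.
exact/(computable_comp compF)/computable_snd/computable_snd/computable_id.
Qed.

Lemma computable_add f g :
  computable_in A f -> computable_in A g ->
  computable_in A (fun x => f x + g x).
Proof.
move=> compf compg.
have := computable_iter (computable_succ computable_id) compf compg.
by congr computable_in; apply/funext => x; rewrite iter_succn addnC.
Qed.

Lemma computable_sub f g :
  computable_in A f -> computable_in A g ->
  computable_in A (fun x => f x - g x).
Proof.
move=> compf compg.
have := computable_iter (computable_pred computable_id) compg compf.
by congr computable_in; apply/funext => x; rewrite iter_predn.
Qed.

Lemma computable_mull m f :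
  computable_in A f -> computable_in A (fun x => m * f x).
Proof.
move=> compf.
have := computable_iter (computable_add (computable_const m) computable_id)
  compf (computable_const 0).
by congr computable_in; apply/funext => x; rewrite iter_addn_0.
Qed.

Lemma decidable_eq f g :
  computable_in A f -> computable_in A g -> decidable_in (fun x => f x == g x).
Proof.
move=> compf compg.
have := @computable_primrec (fun _ m => m == 0) (fun=> 1) (fun=> 0) (fun=> 0)
  (fun x => (f x - g x) + (g x - f x)).
have -> : (fun x => (f x - g x + (g x - f x) == 0) : nat)
        = (fun x => (f x == g x) : nat).
  by apply/funext => x; congr nat_of_bool; lia.
by apply=> //; try exact: computable_const; apply: computable_add;
  apply: computable_sub.
Qed.

Lemma computable_if (b : nat -> bool) f g :
  decidable_in b -> computable_in A f -> computable_in A g ->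
  computable_in A (fun x => if b x then f x else g x).
Proof.
move=> decb compf compg.
have := @computable_primrec (fun a m => if m is 0 then g a else f a) g
  (fun z => f (nfst z)) id b.
have -> : (fun x => if b x : nat is 0 then g (id x) else f (id x))
        = (fun x => if b x then f x else g x).
  by apply/funext => x; case: (b x).
apply=> //; last exact: computable_id.
  by move=> a m; rewrite npairE.
exact/(computable_comp compf)/computable_fst/computable_id.
Qed.

End Closure.

(* The shape of the body of the function selects the closure property. *)
Ltac computability :=
  cbv beta zeta; first
  [ assumption
  | lazymatch goal with
    | |- decidable_in _ (fun x => _ == _) => apply: decidable_eq
    | |- computable_in _ (fun x => x) => exact: computable_id
    | |- computable_in _ (fun x => if _ then _ else _) => apply: computable_if
    | |- computable_in _ (fun x => npair _ _) => apply: computable_pair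
    | |- computable_in _ (fun x => nfst _) => apply: computable_fst
    | |- computable_in _ (fun x => nsnd _) => apply: computable_snd
    | |- computable_in _ (fun x => charfun _ _) => apply: computable_charfun
    | |- computable_in _ (fun x => iter _ _ _) => apply: computable_iter
    | |- computable_in _ (fun x => addn _ _) => apply: computable_add
    | |- computable_in _ (fun x => subn _ _) => apply: computable_sub
    | |- computable_in _ (fun x => muln _ _) => apply: computable_mull
    | |- computable_in _ (fun x => _.-1) => apply: computable_pred
    | |- computable_in _ (fun x => _.+1) => apply: computable_succ
    | |- computable_in _ (fun=> ?n) => exact: computable_const
    | |- computable_in _ (fun x => ?f _) =>
        apply: (@computable_comp _ f); [assumption | ]
    | |- computable_in _ id => exact: computable_id
    | |- computable_in ?A ?f => change (computable_in A (fun x => f x))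
    end; computability ].

(** If the oracle B is computable from A, then replacing the oracle calls by
    the code that computes B turns codes with oracle B into codes with
    oracle A. *)
Lemma partial_computable_trans (A B : set nat) psi :
  computable_in A (charfun B) ->
  partial_computable_in B psi -> partial_computable_in A psi.
Proof.
move=> /partial_computableP[b Eb] /partial_computableP[c ->].
apply/partial_computableP.
suff [c' Ec'] : exists c', forall x y, eval B c x y <-> eval A c' x y.
  by exists c'; apply/funext => x; apply/funext => y; apply/propext.
elim: c => [|||||c1 [d1 E1] c2 [d2 E2]|c1 [d1 E1] c2 [d2 E2]
  |c1 [d1 E1] c2 [d2 E2]|c1 [d1 E1]].
- by exists CZero.
- by exists CSucc.
- by exists CFst.
- by exists CSnd.
- by exists b; rewrite -Eb.
all: have {}E1 : eval B c1 = eval A d1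
  by apply/funext => x; apply/funext => y; exact/propext.
all: try have {}E2 : eval B c2 = eval A d2
  by apply/funext => x; apply/funext => y; exact/propext.
- by exists (CPair d1 d2); rewrite /= E1 E2.
- by exists (CComp d1 d2); rewrite /= E1 E2.
- by exists (CPrec d1 d2); rewrite /= E1 E2.
- by exists (CMu d1); rewrite /= E1.
Qed.

Lemma computable_weaken A f : computable_in set0 f -> computable_in A f.
Proof.
apply: partial_computable_trans.
suff -> : charfun set0 = fun=> 0 by exact: computable_const.
by apply/funext => n; rewrite /charfun asboolF.
Qed.

(** * The universal machine *)

(** The machine is a stack machine whose states [npair v K] carry the value v
    just produced and the stack K of pending frames; the empty stack is 0.
    Evaluation of a code is itself a pending frame (of kind 0), so that there
    is no separate mode for calls.  The other kinds of frames remember what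
    remains to be done in a pairing (1 and 2), in a primitive recursion (3)
    and in a minimization (4). *)
Definition push k d K := (npair (npair k d) K).+1.
Definition call e K := push 0 e K.

(** The indices are arranged periodically: the tags run through 0, ..., 8 and
    then again through 5, ..., 8, and the argument grows by one in each new
    round.  Counting up to an index thus decodes it without a division. *)
Definition next_index z :=
  if nfst z == 8 then npair 5 (nsnd z).+1 else npair (nfst z).+1 (nsnd z).
Definition decode e := iter e next_index (npair 0 0).

Section Machine.
Variable A : set nat.

Definition apply_code e x K :=
  let t := nfst (decode e) in let q := nsnd (decode e) in
  if t == 0 then npair 0 K
  else if t == 1 then npair x.+1 K
  else if t == 2 then npair (nfst x) K
  else if t == 3 then npair (nsnd x) K
  else if t == 4 then npair (charfun A x) K
  else if t == 5 then
    npair x (call (nfst q) (push 1 (npair (nsnd q) x) K))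
  else if t == 6 then npair x (call (nsnd q) (call (nfst q) K))
  else if t == 7 then
    npair (nfst x) (call (nfst q)
      (push 3 (npair (nsnd q) (npair (nfst x) (npair 0 (nsnd x)))) K))
  else npair (npair x 0) (call q (push 4 (npair q (npair x 0)) K)).

Definition resume_prec c a m k v K :=
  if k == 0 then npair v K
  else npair (npair a (npair m v))
         (call c (push 3 (npair c (npair a (npair m.+1 k.-1))) K)).

Definition resume_mu c x m v K :=
  if v == 0 then npair m K
  else npair (npair x m.+1) (call c (push 4 (npair c (npair x m.+1)) K)).

Definition resume k d v K :=
  if k == 0 then apply_code d v K
  else if k == 1 then npair (nsnd d) (call (nfst d) (push 2 v K))
  else if k == 2 then npair (npair d v) K
  else if k == 3 then
    resume_prec (nfst d) (nfst (nsnd d)) (nfst (nsnd (nsnd d)))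
      (nsnd (nsnd (nsnd d))) v K
  else resume_mu (nfst d) (nfst (nsnd d)) (nsnd (nsnd d)) v K.

Definition step s :=
  if nsnd s == 0 then s
  else resume (nfst (nfst (nsnd s).-1)) (nsnd (nfst (nsnd s).-1)) (nfst s)
         (nsnd (nsnd s).-1).

Lemma computable_decode : computable_in A decode.
Proof. rewrite /decode /next_index; computability. Qed.

Lemma computable_step : computable_in A step.
Proof.
have compD := computable_decode.
rewrite /step /resume /resume_prec /resume_mu /apply_code /call /push.
computability.
Qed.

Lemma stepE v k d K : step (npair v (push k d K)) = resume k d v K.
Proof. by rewrite /step /push !npairE. Qed.

Lemma decode5 q : decode (5 + 4 * q) = npair 5 q.
Proof.
elim: q => [|q IHq]; first by rewrite /decode /next_index /= !npairE.
have -> : 5 + 4 * q.+1 = 4 + (5 + 4 * q) by lia.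
by rewrite /decode iterD -/(decode _) IHq /next_index /= !npairE.
Qed.

Lemma decodeE c : decode (encode c) =
  match c with
  | CZero => npair 0 0 | CSucc => npair 1 0 | CFst => npair 2 0
  | CSnd => npair 3 0 | COracle => npair 4 0
  | CPair c1 c2 => npair 5 (npair (encode c1) (encode c2))
  | CComp c1 c2 => npair 6 (npair (encode c1) (encode c2))
  | CPrec c1 c2 => npair 7 (npair (encode c1) (encode c2))
  | CMu c1 => npair 8 (encode c1)
  end.
Proof.
case: c => [|||||c1 c2|c1 c2|c1 c2|c1].
1-5: by rewrite /decode /next_index /= ?npairE.
- exact: decode5.
- have := decode5 (npair (encode c1) (encode c2)); set e := 5 + _ => De.
  rewrite -[encode _]/(1 + e) /decode iterD -/(decode _) De /=.
  by rewrite /next_index !npairE.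
- have := decode5 (npair (encode c1) (encode c2)); set e := 5 + _ => De.
  rewrite -[encode _]/(2 + e) /decode iterD -/(decode _) De /=.
  by rewrite /next_index !npairE.
- have := decode5 (encode c1); set e := 5 + _ => De.
  rewrite -[encode _]/(3 + e) /decode iterD -/(decode _) De /=.
  by rewrite /next_index !npairE.
Qed.

Lemma step_call c x K : step (npair x (call (encode c) K)) =
  match c with
  | CZero => npair 0 K
  | CSucc => npair x.+1 K
  | CFst => npair (nfst x) K
  | CSnd => npair (nsnd x) K
  | COracle => npair (charfun A x) K
  | CPair c1 c2 =>
      npair x (call (encode c1) (push 1 (npair (encode c2) x) K))
  | CComp c1 c2 => npair x (call (encode c2) (call (encode c1) K))
  | CPrec c1 c2 =>
      npair (nfst x) (call (encode c1)
        (push 3 (npair (encode c2) (npair (nfst x) (npair 0 (nsnd x)))) K))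
  | CMu c1 =>
      npair (npair x 0)
        (call (encode c1) (push 4 (npair (encode c1) (npair x 0)) K))
  end.
Proof.
rewrite /call stepE /resume /= /apply_code decodeE.
by case: c => *; rewrite !npairE.
Qed.

Lemma step_pair1 c x u K :
  step (npair u (push 1 (npair c x) K)) = npair x (call c (push 2 u K)).
Proof. by rewrite stepE /resume /= !npairE. Qed.

Lemma step_pair2 u v K : step (npair v (push 2 u K)) = npair (npair u v) K.
Proof. by rewrite stepE. Qed.

Lemma step_prec c a m k v K :
  step (npair v (push 3 (npair c (npair a (npair m k))) K))
  = resume_prec c a m k v K.
Proof. by rewrite stepE /resume /= !npairE. Qed.

Lemma step_mu c x m v K :
  step (npair v (push 4 (npair c (npair x m)) K)) = resume_mu c x m v K.
Proof. by rewrite stepE /resume /= !npairE. Qed.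

(** ** Computations of codes are followed by the machine *)

Definition reaches s s' := exists t, iter t step s = s'.

Lemma reaches_refl s : reaches s s.
Proof. by exists 0. Qed.

Lemma reaches_step s s' : reaches (step s) s' -> reaches s s'.
Proof. by move=> [t <-]; exists t.+1; rewrite iterSr. Qed.

Lemma reaches_trans s1 s2 s3 : reaches s1 s2 -> reaches s2 s3 -> reaches s1 s3.
Proof. by move=> [t <-] [t' <-]; exists (t' + t); rewrite iterD. Qed.

Lemma eval_reaches c x y K :
  eval A c x y -> reaches (npair x (call (encode c) K)) (npair y K).
Proof.
elim: c x y K => [|||||c1 IH1 c2 IH2|c1 IH1 c2 IH2|c1 IH1 c2 IH2|c1 IH1] x y K.
1-5: move=> Ey; apply: reaches_step; rewrite step_call; move: Ey => /= ->;
  exact: reaches_refl.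
- move=> [u [v [/IH1 Hu /IH2 Hv ->]]]; apply: reaches_step; rewrite step_call.
  apply: reaches_trans (Hu _) _; apply: reaches_step; rewrite step_pair1.
  apply: reaches_trans (Hv _) _; apply: reaches_step; rewrite step_pair2.
  exact: reaches_refl.
- move=> [z /IH2 Hz /IH1 Hy]; apply: reaches_step; rewrite step_call.
  exact: reaches_trans (Hz _) (Hy _).
- (* After m rounds the counter has gone down from m + k to k. *)
  have loop a m k z : prec_graph (eval A c1) (eval A c2) a m z ->
      reaches (npair (npair a (m + k)) (call (encode (CPrec c1 c2)) K))
        (npair z (push 3 (npair (encode c2) (npair a (npair m k))) K)).
    elim: m k z => [|m IHm] k z /=.
      move=> /IH1 Hz; apply: reaches_step.
      rewrite (step_call (CPrec c1 c2)) !npairE.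
      exact: Hz.
    move=> [w /(IHm k.+1) Hw /IH2 Hz]; rewrite addSnnS.
    apply: reaches_trans Hw _; apply: reaches_step.
    by rewrite step_prec; apply: Hz.
  move=> /= /(loop _ _ 0); rewrite addn0 npair_eta => Hy.
  apply: reaches_trans Hy _; apply: reaches_step; rewrite step_prec.
  exact: reaches_refl.
- move=> /= [/IH1 Hy lty].
  (* By minimality, every m up to y is tried. *)
  have loop m : m <= y ->
      reaches (npair x (call (encode (CMu c1)) K))
        (npair (npair x m) (call (encode c1)
           (push 4 (npair (encode c1) (npair x m)) K))).
    elim: m => [|m IHm] lemy.
      by apply: reaches_step; rewrite (step_call (CMu c1)); exact: reaches_refl.
    have [k /IH1 Hk] := lty _ lemy.
    apply: reaches_trans (IHm (ltnW lemy)) _; apply: reaches_trans (Hk _) _.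
    by apply: reaches_step; rewrite step_mu; apply: reaches_refl.
  apply: reaches_trans (loop _ (leqnn y)) _; apply: reaches_trans (Hy _) _.
  by apply: reaches_step; rewrite step_mu; apply: reaches_refl.
Qed.

(** ** Halting runs of the machine come from computations of codes *)

Definition halts t s := nsnd (iter t step s) = 0.

Lemma halts_push t v k d K :
  halts t (npair v (push k d K)) ->
  exists2 t', t' < t & halts t' (step (npair v (push k d K))).
Proof.
case: t => [|t]; first by rewrite /halts /= npairE.
by rewrite /halts iterSr; exists t.
Qed.

(** Every step that is followed makes the remaining run shorter, so that
    induction on the length of the run bounds the number of rounds of a
    minimization. *)
Lemma halts_eval c x K t :
  halts t (npair x (call (encode c) K)) ->
  exists y t', [/\ t' <= t, eval A c x y & halts t' (npair y K)].
Proof.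
elim: c x K t => [|||||c1 IH1 c2 IH2|c1 IH1 c2 IH2|c1 IH1 c2 IH2|c1 IH1] x K t
  /halts_push[t1 lt1]; rewrite -/(call _ _) step_call => H1.
1-5: by eexists _, t1; split; [exact: ltnW | reflexivity |].
- have [u [t2 [le2 Hu]]] := IH1 _ _ _ H1.
  move=> /halts_push[t3 lt3]; rewrite step_pair1 => H3.
  have [v [t4 [le4 Hv]]] := IH2 _ _ _ H3.
  move=> /halts_push[t5 lt5]; rewrite step_pair2 => H5.
  by exists (npair u v), t5; split=> //; [lia | exists u, v].
- have [z [t2 [le2 Hz H2]]] := IH2 _ _ _ H1.
  have [y [t3 [le3 Hy H3]]] := IH1 _ _ _ H2.
  by exists y, t3; split=> //; [lia | exists z].
- have loop a m k z t2 : prec_graph (eval A c1) (eval A c2) a m z ->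
      halts t2 (npair z (push 3 (npair (encode c2) (npair a (npair m k))) K)) ->
      exists y t', [/\ t' <= t2,
        prec_graph (eval A c1) (eval A c2) a (m + k) y & halts t' (npair y K)].
    elim: k m z t2 => [|k IHk] m z t2 Hz /halts_push[t3 lt3];
      rewrite step_prec /resume_prec /= => H3.
      by exists z, t3; rewrite addn0; split=> //; exact: ltnW.
    have [w [t4 [le4 Hw H4]]] := IH2 _ _ _ H3.
    have Hm : prec_graph (eval A c1) (eval A c2) a m.+1 w by exists z.
    have [y [t5 [le5 Hy H5]]] := IHk _ _ _ Hm H4.
    by exists y, t5; rewrite -addSnnS; split=> //; lia.
  have [z [t2 [le2 Hz H2]]] := IH1 _ _ _ H1.
  have [y [t3 [le3 Hy H3]]] := loop _ 0 _ _ _ Hz H2.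
  by exists y, t3; split=> //; lia.
- have loop t2 m : (forall i, i < m -> exists k, eval A c1 (npair x i) k.+1) ->
      halts t2 (npair (npair x m)
        (call (encode c1) (push 4 (npair (encode c1) (npair x m)) K))) ->
      exists y t', [/\ t' <= t2, eval A (CMu c1) x y & halts t' (npair y K)].
    elim/ltn_ind: t2 m => t2 IHt m Hm H2.
    have [v [t3 [le3 Hv]]] := IH1 _ _ _ H2.
    move=> /halts_push[t4 lt4]; rewrite step_mu /resume_mu.
    case: v Hv => [|v] Hv /= H4; first by exists m, t4; split=> //; lia.
    have Hm' i : i < m.+1 -> exists k, eval A c1 (npair x i) k.+1.
      by rewrite ltnS leq_eqVlt => /predU1P[->|/Hm //]; exists v.
    have [|y [t5 [le5 Hy H5]]] := IHt t4 _ m.+1 Hm' H4; first by lia.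
    by exists y, t5; split=> //; lia.
  have [//|y [t2 [le2 Hy H2]]] := loop _ 0 _ H1.
  by exists y, t2; split=> //; lia.
Qed.

(** A halted state is a fixed point of [step], whence the value found does not
    depend on the stage at which the run is inspected. *)
Lemma halts_same t t' s :
  halts t s -> halts t' s -> iter t step s = iter t' step s.
Proof.
have later r r' : halts r s -> r <= r' -> iter r' step s = iter r step s.
  move=> Hr /subnK <-; elim: (r' - r) => //= n ->.
  by rewrite /step Hr.
move=> Ht Ht'; case: (leqP t t') => [|/ltnW] le.
  by rewrite (later t t').
by rewrite (later t' t).
Qed.

End Machine.

(** Kleene's normal form: T says that the machine has halted after t steps,
    and out is the value that it then carries. *)
Lemma normal_form A : exists (T : nat -> bool) (out : nat -> nat),
  [/\ decidable_in A T, computable_in A out,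
      forall e x t, T (npair (npair e x) t) ->
        phi A e x (out (npair (npair e x) t)) &
      forall e x y, phi A e x y -> exists t, T (npair (npair e x) t)].
Proof.
pose run z := iter (nsnd z) (step A)
  (npair (nsnd (nfst z)) (push 0 (nfst (nfst z)) 0)).
have comp_run : computable_in A run.
  have compS := computable_step A; rewrite /run /push; computability.
have runE e x t : run (npair (npair e x) t) =
    iter t (step A) (npair x (call e 0)) by rewrite /run !npairE.
exists (fun z => nsnd (run z) == 0), (fun z => nfst (run z)); split.
- computability.
- computability.
- move=> e x t /eqP; rewrite runE -/(halts _ _ _).
  have [c <-] := encode_surj e; rewrite phi_encode => Ht.
  have [y [_ [_ Hy _]]] := halts_eval Ht.
  have [t' Et'] := eval_reaches 0 Hy.
  rewrite (halts_same Ht (_ : halts A t' _)) ?Et' ?npairE //.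
  by rewrite /halts Et' npairE.
- move=> e x y; have [c <-] := encode_surj e.
  rewrite phi_encode => /(@eval_reaches _ _ _ _ 0)[t Et].
  by exists t; rewrite runE Et npairE.
Qed.

Lemma eval_mu A (b : nat -> bool) : decidable_in A b -> exists c,
  (forall x t, eval A c x t -> b (npair x t)) /\
  (forall x t, b (npair x t) -> exists t', eval A c x t').
Proof.
move=> decb.
have : computable_in A (fun z => 1 - b z) by computability.
move=> /computableP[c Ec]; exists (CMu c); split=> x t /=.
  by move=> [/eval_functional/(_ (Ec _))]; case: (b _).
move=> bt; have exb : exists t, b (npair x t) by exists t.
case: (ex_minnP exb) => t' bt' mint'; exists t'; split.
  by have := Ec (npair x t'); rewrite bt'.
move=> m ltm; exists 0; have := Ec (npair x m).
by case bm: (b _) => //; have := mint' _ bm; rewrite leqNgt ltm.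
Qed.

Lemma universal_code A : exists U, forall e x y,
  eval A U (npair e x) y <-> phi A e x y.
Proof.
have [T [out [decT /computableP[co Eo] sound complete]]] := normal_form A.
have [cT [cT_sound cT_complete]] := eval_mu decT.
exists (CComp co (CPair CId cT)) => e x y; split=> [|Hy].
  move=> [_ [_ [t [/(@eval_CIdP A) -> /cT_sound Tt ->]]] Hy].
  by rewrite (eval_functional Hy (Eo _)); exact: sound.
have [t /cT_complete[t' Ht']] := complete _ _ _ Hy.
exists (npair (npair e x) t').
  by exists (npair e x), t'; split=> //; exact: eval_CId.
have := Eo (npair (npair e x) t').
by rewrite (phi_functional (sound _ _ _ (cT_sound _ _ Ht')) Hy).
Qed.

(** Dovetailing: search for i together with a stage at which p has entered
    the i-th set. *)
Lemma ce_selection A e : computable_in A e -> exists d,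
  (forall p i, eval A d p i -> W A (e i) p) /\
  (forall p i, W A (e i) p -> exists j, eval A d p j).
Proof.
move=> compe; have [T [out [decT _ sound complete]]] := normal_form A.
pose b z := T (npair (npair (e (nfst (nsnd z))) (nfst z)) (nsnd (nsnd z))).
have [|c [c_sound c_complete]] := @eval_mu A b.
  by apply: (computable_comp decT); computability.
exists (CComp CFst c); split=> p i.
  move=> [z /c_sound + /= ->]; rewrite /b !npairE => /sound.
  by eexists; eassumption.
move=> [y /complete[t Tt]].
have [|z Hz] := c_complete p (npair i t); first by rewrite /b !npairE.
by exists (nfst z); exists z.
Qed.

(** * The s-m-n theorem *)

Fixpoint const_code n := if n is m.+1 then CComp CSucc (const_code m) else CZero.

Lemma eval_const_code A n x : eval A (const_code n) x n.
Proof. by elim: n => //= n IHn; exists n. Qed.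

Definition curry_code c i := CComp c (CPair (const_code i) CId).

Lemma eval_curry A c i x y :
  eval A (curry_code c i) x y <-> eval A c (npair i x) y.
Proof.
split=> [[_ [u [v [Hu /(@eval_CIdP A) -> ->]]]]|Hy].
  by rewrite (eval_functional Hu (eval_const_code _ _ _)).
exists (npair i x) => //; exists i, x.
by split=> //; [exact: eval_const_code|exact: eval_CId].
Qed.

Lemma computable_curry A c : computable_in A (fun i => encode (curry_code c i)).
Proof.
pose f i := iter i (fun z => 6 + 4 * npair 1 z) 0.
have Ef i : encode (const_code i) = f i by elim: i => //= i ->.
have compf : computable_in A f by rewrite /f; computability.
have : computable_in A (fun i => 6 + 4 * npair (encode c)
    (5 + 4 * npair (f i) (encode CId))) by computability.
by congr computable_in; apply/funext => i; rewrite -Ef.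
Qed.

(** * Precomplete and divisible numberings *)

Section Equivalence.
Variables (T : Type) (gamma : nat -> T) (A : set nat).

Lemma computable_set_low : computable_set A -> low gamma A.
Proof.
move=> compA f compf; exists f => //.
exact: partial_computable_trans compf.
Qed.

Lemma computable_set_precomplete :
  precomplete gamma -> computable_set A -> precomplete_in A gamma.
Proof.
move=> preg compA psi /(partial_computable_trans compA)/preg[f compf Hf].
by exists f => //; exact: computable_weaken.
Qed.

(** The sets of a division tell the classes of the x i apart, so that i can be
    read off from any representative of the class of x i. *)
Lemma omega_divisible_decode : omega_divisible gamma ->
  exists2 x, computable_in set0 x &
  exists d, forall p i, gamma p = gamma (x i) -> eval set0 d p i.
Proof.
move=> [x [e [compx compe sub_e disj_e]]]; exists x => //.
have [d [d_sound d_complete]] := ce_selection compe.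
exists d => p i Ep; have [j Hj] := d_complete p i (sub_e i p Ep).
have [<-//|/eqP neq_ij] := eqVneq j i.
suff : (@set0 nat) p by [].
by rewrite -(disj_e i j); [split=> //; exact: d_sound | exact/nesym].
Qed.

(** The characteristic function picks x 0 or x 1; a computable choice of
    representatives of the same classes can be decoded computably. *)
Lemma low_computable_set :
  omega_divisible gamma -> low gamma A -> computable_set A.
Proof.
move=> /omega_divisible_decode[x compx [d Hd]] lowA.
have [|g /computableP[cg Eg] Hg] := lowA (fun n => x (charfun A n)).
  have compxA : computable_in A x by exact: computable_weaken.
  computability.
by apply/computableP; exists (CComp d cg) => n; exists (g n) => //; exact: Hd.
Qed.

(** Let f make the diagonal a, m |-> phi_a(a, m) of the universal function
    total modulo gamma.  The function f is available when the index a is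
    chosen, so that f(a, m) can be made equivalent to x i for the i that codes
    both f(a, m + 1) and the bit m of A.  Decoding i from f(a, m) is
    computable without oracle, and leads from the single number f(a, 0)
    through all f(a, m), hence through all bits of A. *)
Lemma precomplete_in_computable_set :
  omega_divisible gamma -> precomplete_in A gamma -> computable_set A.
Proof.
move=> /omega_divisible_decode[x compx [d Hd]] preA.
have [U HU] := universal_code A.
(* The index a is itself part of the input of phi_a: this is how a program
   gets to know its own index. *)
pose psi := eval A (CComp U (CPair CFst CId)).
have [f compf Hf] : exists2 f, computable_in A f &
    forall n v, psi n v -> gamma v = gamma (f n).
  by apply: preA; apply/partial_computableP; eexists.
pose h z := x (npair (f (npair (nfst z) (nsnd z).+1)) (charfun A (nsnd z))).
have /computableP[b Eb] : computable_in A h.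
  have compxA : computable_in A x by exact: computable_weaken.
  rewrite /h; computability.
pose p m := f (npair (encode b) m).
have pE m : eval set0 d (p m) (npair (p m.+1) (charfun A m)).
  apply/Hd/esym/Hf; set z := npair _ m.
  exists (npair (encode b) z).
    exists (encode b), z; split=> //; last exact: eval_CId.
    by rewrite /= nfst_npair.
  by apply/HU; rewrite phi_encode; have := Eb z; rewrite /h /z !npairE.
have /computableP[cp Ep] : computable_in set0 p.
  have [c Ec] : exists c, forall m, eval set0 c (npair 0 m) (p m).
    exists (CPrec (const_code (p 0)) (CComp CFst (CComp d (CComp CSnd CSnd)))).
    move=> m /=; rewrite !npairE.
    elim: m => [|m IHm] /=; first exact: eval_const_code.
    exists (p m) => //; exists (npair (p m.+1) (charfun A m)); last first.
      by rewrite npairE.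
    by exists (p m) => //; exists (npair m (p m)); rewrite !npairE.
  have /computableP[c0 Ec0] : computable_in set0 (fun m => npair 0 m).
    computability.
  by apply/computableP; exists (CComp c c0) => m; exists (npair 0 m).
apply/computableP; exists (CComp CSnd (CComp d cp)) => m.
exists (npair (p m.+1) (charfun A m)); last by rewrite /= npairE.
by exists (p m).
Qed.

Lemma computable_low_precomplete : precomplete gamma -> omega_divisible gamma ->
  [<-> computable_set A; low gamma A; precomplete_in A gamma].
Proof.
move=> preg divg; tfae.
- exact: computable_set_low.
- by move/(low_computable_set divg); exact: computable_set_precomplete.
- exact: precomplete_in_computable_set.
Qed.

End Equivalence.

(** * The standard numberings *)

(** Given psi, the index f n is that of x |-> phi_(psi n)(x), which waits for
    psi n to converge before it looks at x. *)
Lemma precomplete_standard T (gamma : nat -> T) :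
  (forall m n, phi set0 m = phi set0 n -> gamma m = gamma n) ->
  precomplete gamma.
Proof.
move=> gammaE psi /partial_computableP[c ->].
have [U HU] := universal_code set0.
pose D := CComp U (CPair (CComp c CFst) CSnd).
exists (fun n => encode (curry_code D n)); first exact: computable_curry.
move=> n v Hv; apply: gammaE; rewrite phi_encode.
apply/funext => x; apply/funext => y; apply/propext.
rewrite eval_curry -HU /=; split=> [Hy|].
  exists (npair v x) => //; exists v, x; rewrite !npairE; split=> //.
  by exists n; rewrite // npairE.
move=> [_ [u [_ [[_ -> Hu] -> ->]]]]; rewrite npairE in Hu.
by rewrite (eval_functional Hu Hv) npairE.
Qed.

(** If x i is an index of {i}, then every n in its class satisfies W_n = {i};
    so the class is contained in the c.e. set of all n with i in W_n, which
    meets the class of no other x j. *)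
Lemma omega_divisible_standard T (gamma : nat -> T) :
  (forall m n, gamma m = gamma n -> W set0 m = W set0 n) ->
  omega_divisible gamma.
Proof.
move=> gammaE; have [U HU] := universal_code set0.
have [|c [c_sound c_complete]] :=
    @eval_mu set0 (fun z => nfst (nfst z) == nsnd (nfst z)).
  by computability.
pose x i := encode (curry_code c i).
pose e i := encode (curry_code (CComp U (CPair CSnd CFst)) i).
have Wx i n : W set0 (x i) n <-> n = i.
  rewrite /W /= /x phi_encode; split=> [[y]|->].
    by move=> /eval_curry/c_sound; rewrite !npairE => /eqP.
  have [|t Ht] := c_complete (npair i i) 0; first by rewrite !npairE.
  by exists t; exact/eval_curry.
have We i n : W set0 (e i) n <-> W set0 n i.
  rewrite /W /= /e phi_encode.
  split=> -[y].
    move=> /eval_curry[_ [_ [_ [-> -> ->]]]] /=; rewrite !npairE => /HU.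
    by exists y.
  move=> /HU Hy; exists y; apply/eval_curry; exists (npair n i) => //.
  by exists n, i; rewrite /= !npairE.
exists x, e; split; try exact: computable_curry.
  by move=> i n /gammaE En; apply/We; rewrite En; apply/Wx.
move=> i j neq_ij; apply/seteqP; split=> // n [/gammaE En /We].
by rewrite En => /Wx /esym.
Qed.

Theorem theorem3p6 :
  (forall (T : Type) (S : set T) (gamma : nat -> T) (A : set nat),
      numbering S gamma -> precomplete gamma -> omega_divisible gamma ->
      [<-> computable_set A; low gamma A; precomplete_in A gamma])
  /\ (forall A : set nat,
      [<-> computable_set A; low (W set0) A; precomplete_in A (W set0)])
  /\ (forall A : set nat,
      [<-> computable_set A; low (phi set0) A; precomplete_in A (phi set0)]).
Proof.
split=> [T S gamma A _|]; first exact: computable_low_precomplete.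
have W_phi m n : phi set0 m = phi set0 n -> W set0 m = W set0 n.
  by rewrite /W => ->.
split=> A; apply: computable_low_precomplete.
- exact: precomplete_standard.
- exact: omega_divisible_standard.
- exact: precomplete_standard.
- exact: omega_divisible_standard.
Qed.
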